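(* Let $M\in\mathbb{C}^{p\times p}$ be invertible, let $\mathcal{A}\in\mathbb{C}^{m\times n\times p}$ have multirank $\mathrm{rank}_M(\mathcal{A})=(r,r,\ldots,r)$, and let $\mathcal{B}\in\mathbb{C}^{m\times m\times p}$ have tubal index $k$. (i) If $\mathcal{A}^*=\mathcal{S}*_M\mathcal{T}$ is a full-rank decomposition of $\mathcal{A}^*$, then $\mathcal{A}^\dagger=\mathcal{S}*_M(\mathcal{T}*_M\mathcal{A}*_M\mathcal{S})^{-1}*_M\mathcal{T}$. (ii) If $\mathcal{B}^k=\mathcal{S}*_M\mathcal{T}$ is a full-rank decomposition of $\mathcal{B}^k$, then $\mathcal{B}^{D}=\mathcal{S}*_M(\mathcal{T}*_M\mathcal{B}*_M\mathcal{S})^{-1}*_M\mathcal{T}$.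
   Context: For $\mathcal{A}\in\mathbb{C}^{m\times n\times p}$ and an invertible $M\in\mathbb{C}^{p\times p}$, let $\tilde{\mathcal{A}}=\mathcal{A}\times_3 M$, i.e. $\tilde{\mathcal{A}}(i,j,k)=\sum_{l=1}^p M(k,l)\,\mathcal{A}(i,j,l)$. The $k$-th frontal slice of $\tilde{\mathcal{A}}$ is the matrix $\tilde{\mathcal{A}}(:,:,k)$. M-product: for $\mathcal{A}\in\mathbb{C}^{m\times n\times p}$ and $\mathcal{B}\in\mathbb{C}^{n\times q\times p}$, $\mathcal{A}*_M\mathcal{B}\in\mathbb{C}^{m\times q\times p}$ is the unique tensor $\mathcal{C}$ with $\tilde{\mathcal{C}}(:,:,k)=\tilde{\mathcal{A}}(:,:,k)\tilde{\mathcal{B}}(:,:,k)$ for all $k=1,\ldots,p$. Powers are taken with respect to $*_M$; $\mathcal{B}^0$ is the identity tensor, whose transform has all frontal slices equal to the identity matrix. A tensor $\mathcal{A}\in\mathbb{C}^{n\times n\times p}$ is invertible if every frontal slice of $\tilde{\mathcal{A}}$ is invertible; then $\widetilde{\mathcal{A}^{-1}}(:,:,k)=(\tilde{\mathcal{A}}(:,:,k))^{-1}$. Conjugate transpose: $\mathcal{A}^*\in\mathbb{C}^{n\times m\times p}$ is the tensor with $\widetilde{\mathcal{A}^*}(:,:,k)=(\tilde{\mathcal{A}}(:,:,k))^*$ for all $k$. Multirank: $\mathrm{rank}_M(\mathcal{A})=(r_1,\ldots,r_p)$ with $r_k=\mathrm{rank}(\tilde{\mathcal{A}}(:,:,k))$.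 Tubal rank: $\mathrm{rank}_t(\mathcal{A})=\max_k r_k$. Full-rank decomposition (FRD): if $\mathcal{A}\in\mathbb{C}^{m\times n\times p}$ has $\mathrm{rank}_t(\mathcal{A})=r$, then $\mathcal{A}=\mathcal{S}*_M\mathcal{T}$ is an FRD of $\mathcal{A}$ when $\mathcal{S}\in\mathbb{C}^{m\times r\times p}$, $\mathcal{T}\in\mathbb{C}^{r\times n\times p}$ and $\mathrm{rank}_t(\mathcal{S})=r=\mathrm{rank}_t(\mathcal{T})$. Moore-Penrose inverse: $\mathcal{A}^{\dagger}\in\mathbb{C}^{n\times m\times p}$ is the unique tensor $\mathcal{Z}$ with $\mathcal{A}*_M\mathcal{Z}*_M\mathcal{A}=\mathcal{A}$, $\mathcal{Z}*_M\mathcal{A}*_M\mathcal{Z}=\mathcal{Z}$, $(\mathcal{A}*_M\mathcal{Z})^*=\mathcal{A}*_M\mathcal{Z}$, $(\mathcal{Z}*_M\mathcal{A})^*=\mathcal{Z}*_M\mathcal{A}$. Index: for a square matrix $A$, $\mathrm{ind}(A)$ is the least integer $k\ge 0$ with $\mathrm{rank}(A^k)=\mathrm{rank}(A^{k+1})$. The tubal index of $\mathcal{B}$ is $\max_{1\le i\le p}\mathrm{ind}(\tilde{\mathcal{B}}(:,:,i))$. Drazin inverse: if $\mathcal{B}$ has tubal index $k$, $\mathcal{B}^D$ is the unique $\mathcal{Z}\in\mathbb{C}^{m\times m\times p}$ with $\mathcal{Z}*_M\mathcal{B}*_M\mathcal{Z}=\mathcal{Z}$, $\mathcal{B}*_M\mathcal{Z}=\mathcal{Z}*_M\mathcal{B}$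 and $\mathcal{Z}*_M\mathcal{B}^{k+1}=\mathcal{B}^k$.
   Formalization: In (ii) the inverse of T*B*S need not exist (e.g. M=I, m=1, p=2, B=(1,0), S=(1,0), T=(1,1)); the formula is proved whenever T*B*S is invertible, and invertibility is proved when B^k has uniform multirank. *)

(* Defs.v *)
(* Written with Mathematical Components (algebra, real-closed) and the
   [realType] of MathComp-Analysis. *)
From HB Require Import structures.
From mathcomp Require Import all_boot all_order all_algebra.
From mathcomp Require Import complex.
From mathcomp Require Import reals.

Set Implicit Arguments.
Unset Strict Implicit.
Unset Printing Implicit Defensive.

Import Order.TTheory GRing.Theory Num.Theory.

#[global] Open Scope ring_scope.
#[global] Open Scope sesquilinear_scope.
#[global] Open Scope complex_scope.

(* An m x n x p tensor is the family of its p frontal slices: the entry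
   A(i,j,k) is [A k i j].  Finite functions make equality extensional. *)
Notation tensor C m n p := {ffun 'I_p -> 'M[C]_(m, n)}.

Section MProduct.
Variables (C : numClosedFieldType) (p : nat) (M : 'M[C]_p).

Definition mode3 (N : 'M[C]_p) m n (A : tensor C m n p) : tensor C m n p :=
  [ffun k => \matrix_(i, j) \sum_(l < p) N k l * A l i j].

Definition hat m n (A : tensor C m n p) : tensor C m n p := mode3 M A.

(* For invertible M, the unique tensor whose transform is F: see [hatK] and
   [unhatK].  All tensors specified by their transform are built with it. *)
Definition unhat m n (F : tensor C m n p) : tensor C m n p :=
  mode3 (invmx M) F.

Definition tprod m n q (A : tensor C m n p) (B : tensor C n q p) :
    tensor C m q p :=
  unhat [ffun k => hat A k *m hat B k].

Definition tid n : tensor C n n p := unhat [ffun=> 1%:M].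

Definition tpow n (A : tensor C n n p) (j : nat) : tensor C n n p :=
  iter j (tprod A) (tid n).

Definition tinvertible n (A : tensor C n n p) : Prop :=
  forall k, hat A k \in unitmx.

(* Only meaningful when [tinvertible A], since [invmx] is total. *)
Definition tinv n (A : tensor C n n p) : tensor C n n p :=
  unhat [ffun k => invmx (hat A k)].

Definition tctrans m n (A : tensor C m n p) : tensor C n m p :=
  unhat [ffun k => (hat A k) ^t*].

Definition multirank m n (A : tensor C m n p) : p.-tuple nat :=
  [tuple \rank (hat A k) | k < p].

Definition tubal_rank m n (A : tensor C m n p) : nat :=
  \max_(k < p) tnth (multirank A) k.

Definition is_frd m n r (A : tensor C m n p)
    (S : tensor C m r p) (T : tensor C r n p) : Prop :=
  [/\ tubal_rank A = r, A = tprod S T, tubal_rank S = r & tubal_rank T = r].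

Definition penrose m n (A : tensor C m n p) (Z : tensor C n m p) : Prop :=
  [/\ tprod (tprod A Z) A = A,
      tprod (tprod Z A) Z = Z,
      tctrans (tprod A Z) = tprod A Z
    & tctrans (tprod Z A) = tprod Z A].

(* [unique P Z] is [P Z /\ forall Z', P Z' -> Z = Z']. *)
Definition is_pinv m n (A : tensor C m n p) (Z : tensor C n m p) : Prop :=
  unique (penrose A) Z.

End MProduct.

Lemma ex_index (C : fieldType) n (A : 'M[C]_n) :
  exists k, \rank (A ^+ k) == \rank (A ^+ k.+1).
Proof.
suff H N j : (\rank (A ^+ j) <= N)%N ->
    exists k, \rank (A ^+ k) == \rank (A ^+ k.+1).
  exact: (H _ 0%N (leqnn _)).
elim: N j => [|N IH] j rj; have le : (\rank (A ^+ j.+1) <= \rank (A ^+ j))%N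
  by rewrite exprS; apply: mxrankM_maxr.
  exists j; rewrite eqn_leq le andbT.
  by move: rj; rewrite leqn0 => /eqP ->.
case: (eqVneq (\rank (A ^+ j)) (\rank (A ^+ j.+1))) => [e|ne].
  by exists j; apply/eqP.
apply: (IH j.+1); rewrite -ltnS; apply: leq_trans rj.
by rewrite ltn_neqAle eq_sym ne.
Qed.

Definition mxindex (C : fieldType) n (A : 'M[C]_n) : nat := ex_minn (ex_index A).

Section Drazin.
Variables (C : numClosedFieldType) (p : nat) (M : 'M[C]_p).

Definition tubal_index m (B : tensor C m m p) : nat :=
  \max_(k < p) mxindex (hat M B k).

Definition drazin_eqs m (B Z : tensor C m m p) : Prop :=
  let k := tubal_index B in
  [/\ tprod M (tprod M Z B) Z = Z,
      tprod M B Z = tprod M Z B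
    & tprod M Z (tpow M B k.+1) = tpow M B k].

Definition is_drazin m (B Z : tensor C m m p) : Prop :=
  unique (drazin_eqs B) Z.

End Drazin.

Section Characterization.
Variables (C : numClosedFieldType) (p : nat) (M : 'M[C]_p).
Hypothesis M_unit : M \in unitmx.

Lemma mode3M (N P : 'M[C]_p) m n (A : tensor C m n p) :
  mode3 N (mode3 P A) = mode3 (N *m P) A.
Proof.
apply/ffunP => k; apply/matrixP => i j; rewrite !ffunE !mxE.
under eq_bigr => l _ do rewrite ffunE mxE mulr_sumr.
rewrite exchange_big /=; apply: eq_bigr => l _.
by rewrite mxE mulr_suml; apply: eq_bigr => l' _; rewrite mulrA.
Qed.

Lemma mode31 m n (A : tensor C m n p) : mode3 1%:M A = A.
Proof.
apply/ffunP => k; apply/matrixP => i j; rewrite ffunE mxE (bigD1 k) //=.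
rewrite mxE eqxx mul1r big1 ?addr0 // => l /negbTE kl.
by rewrite mxE eq_sym kl mul0r.
Qed.

Lemma hatK m n : cancel (@hat C p M m n) (@unhat C p M m n).
Proof. by move=> A; rewrite /hat /unhat mode3M mulVmx // mode31. Qed.

Lemma unhatK m n : cancel (@unhat C p M m n) (@hat C p M m n).
Proof. by move=> A; rewrite /hat /unhat mode3M mulmxV // mode31. Qed.

Lemma hat_tprod m n q (A : tensor C m n p) (B : tensor C n q p) k :
  hat M (tprod M A B) k = hat M A k *m hat M B k.
Proof. by rewrite unhatK ffunE. Qed.

End Characterization.

Notation "A *[ M ] B" := (tprod M A B)
  (at level 40, M at level 0, left associativity,
   format "A  *[ M ]  B") : ring_scope.

(* Main.v *)
Require Import Defs.
From HB Require Import structures.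
From mathcomp Require Import all_boot all_order all_algebra.
From mathcomp Require Import complex.
From mathcomp Require Import reals.

(** The transform [hat M] is a bijection that turns the tensor product, powers,
    inverse and conjugate transpose into the corresponding operations on each
    frontal slice.  The Penrose and Drazin equations, and uniqueness of their
    solutions, can therefore be checked slice by slice, and the theorem reduces
    to two facts about matrices.  In both, X = S T is a factorization through
    dimension r, G = T A S and Z = S G^-1 T.

    Invertibility of G comes from a rank count: S G T = X A X, so if X A X has
    rank at least r then so has the r x r matrix G ([core_unit]).  For
    X = A^* this rank is that of A, because X X^* has the rank of X
    ([mxrank_gram]); for X = A^k with k at least the index, X A X = A^(2k+1)
    and the rank of the powers no longer drops ([powmx_index_sub]).

    When G is invertible, Z A S = S and T A Z = T, hence Z A X = X and
    X A Z = X.  For X = A^* these two identities alone give the Penrose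
    equations ([penrose_of_ctrans_cancel]).  For X = A^k they give
    A^(k+1) Z = A^k = Z A^(k+1); the remaining point, that Z commutes with A,
    holds because A commutes with S T, so that A acts on the columns of S and
    on the rows of T by one and the same r x r matrix, which commutes with G
    ([drazin_core_comm]). *)

Set Implicit Arguments.
Unset Strict Implicit.
Unset Printing Implicit Defensive.

Import Order.TTheory GRing.Theory Num.Theory.

(** * Ranks *)

Section Ranks.
Variable C : fieldType.

Lemma core_unit m n r (S : 'M[C]_(m, r)) (G : 'M_r) (T : 'M_(r, n)) :
  (r <= \rank (S *m G *m T))%N -> G \in unitmx.
Proof.
move=> rk; rewrite -row_free_unit -row_leq_rank; apply: leq_trans rk _.
exact: leq_trans (mxrankM_maxl _ _) (mxrankM_maxr _ _).
Qed.

(** At the index j the row spaces of A^j and A^(j+1) coincide, so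
    A^j = D A^(j+1) for some D; iterating, A^j = D^i A^(j+i), and right
    multiplication by a further power of A covers every k >= j. *)
Lemma powmx_index_sub n (A : 'M[C]_n) k i :
  (mxindex A <= k)%N -> (A ^+ k <= A ^+ (k + i))%MS.
Proof.
rewrite /mxindex; case: ex_minnP => j /eqP rk _ /subnKC <-.
have : (A ^+ j <= A ^+ j.+1)%MS.
  have sub : (A ^+ j.+1 <= A ^+ j)%MS by rewrite exprS -mulmxE submxMl.
  by rewrite -(mxrank_leqif_sup sub) rk.
case/submxP => D eD.
have eDi : A ^+ j = D ^+ i *m A ^+ (j + i).
  elim: i => [|i IH]; first by rewrite expr0 mul1mx addn0.
  rewrite exprSr addnS -addSn exprD -!mulmxE -mulmxA (mulmxA D) -eD.
  by rewrite {1}IH exprD.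
by rewrite addnAC exprD [in X in (_ <= X)%MS]exprD {1}eDi -!mulmxE -mulmxA submxMl.
Qed.

End Ranks.

(** * The Moore-Penrose inverse of a matrix *)

Section MoorePenrose.
Variable C : numClosedFieldType.

Definition mxpenrose m n (A : 'M[C]_(m, n)) (Z : 'M_(n, m)) : Prop :=
  [/\ A *m Z *m A = A, Z *m A *m Z = Z,
      (A *m Z) ^t* = A *m Z & (Z *m A) ^t* = Z *m A].

Lemma ctransM m n q (A : 'M[C]_(m, n)) (B : 'M_(n, q)) :
  (A *m B) ^t* = B ^t* *m A ^t*.
Proof. by rewrite trmx_mul map_mxM. Qed.

Lemma mulmx_ctrans_eq0 m n (A : 'M[C]_(m, n)) : A *m A ^t* = 0 -> A = 0.
Proof.
move=> A0; apply/matrixP => i j; rewrite mxE; apply/eqP.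
rewrite -mul_conjC_eq0; apply/eqP; move: j isT.
apply: psumr_eq0P => [j _|]; first exact: mul_conjC_ge0.
move/matrixP/(_ i i): A0; rewrite !mxE => A0.
by rewrite -[RHS]A0; apply: eq_bigr => j _; rewrite !mxE.
Qed.

(** A and A A^* have the same left kernel: if K A A^* = 0 then
    (K A) (K A)^* = 0, and positivity gives K A = 0. *)
Lemma mxrank_gram m n (A : 'M[C]_(m, n)) : \rank (A *m A ^t*) = \rank A.
Proof.
apply/eqP; rewrite eqn_leq mxrankM_maxl /=.
have kA : (kermx (A *m A ^t*) <= kermx A)%MS.
  apply/sub_kermxP/mulmx_ctrans_eq0.
  by rewrite ctransM mulmxA -[_ *m A *m _]mulmxA mulmx_ker mul0mx.
move/mxrankS: kA; rewrite !mxrank_ker => kA.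
by rewrite -(leq_sub2lE _ (rank_leq_row _)).
Qed.

(** Taking adjoints, (A Z)^* A = A and A (Z A)^* = A.  The first gives
    (A Z)^* (A Z) = A Z, and the left-hand side is hermitian; the second does
    the same for Z A. *)
Lemma penrose_of_ctrans_cancel m n (A : 'M[C]_(m, n)) (Z : 'M_(n, m)) :
  Z *m A *m Z = Z -> A ^t* *m A *m Z = A ^t* -> Z *m A *m A ^t* = A ^t* ->
  mxpenrose A Z.
Proof.
move=> ZAZ AAZ ZAA.
have AZA : (A *m Z) ^t* *m A = A.
  have := congr1 (fun X => X ^t*) AAZ.
  by rewrite -mulmxA [LHS]ctransM trmxCK.
have AZA' : A *m (Z *m A) ^t* = A.
  by have := congr1 (fun X => X ^t*) ZAA; rewrite [LHS]ctransM trmxCK.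
have hAZ : (A *m Z) ^t* = A *m Z.
  have e : (A *m Z) ^t* *m (A *m Z) = A *m Z by rewrite mulmxA AZA.
  by rewrite -[in LHS]e ctransM trmxCK.
have hZA : (Z *m A) ^t* = Z *m A.
  have e : Z *m A *m (Z *m A) ^t* = Z *m A by rewrite -mulmxA AZA'.
  by rewrite -[in LHS]e ctransM trmxCK.
by split=> //; rewrite -[in LHS]hAZ.
Qed.

(** A Z = (A W) (A Z) is a product of two hermitian matrices; taking adjoints
    swaps the factors and gives A W.  Symmetrically Z A = W A, whence
    Z = Z A W = W. *)
Lemma mxpenrose_uniq m n (A : 'M[C]_(m, n)) (Z W : 'M_(n, m)) :
  mxpenrose A Z -> mxpenrose A W -> Z = W.
Proof.
case=> AZA ZAZ hAZ hZA [AWA WAW hAW hWA].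
have eAZ : A *m Z = A *m W.
  rewrite -hAZ -[in LHS]AWA -[A *m W *m A *m Z]mulmxA ctransM hAZ hAW.
  by rewrite mulmxA AZA.
have eZA : Z *m A = W *m A.
  rewrite -hZA -[in LHS]AWA [Z *m _]mulmxA [Z *m _]mulmxA -[X in X ^t*]mulmxA.
  by rewrite ctransM hZA hWA -mulmxA [A *m _]mulmxA AZA.
by rewrite -ZAZ eZA -mulmxA eAZ mulmxA.
Qed.

Section FullRank.
Variables (m n r : nat) (A : 'M[C]_(m, n)) (S : 'M[C]_(n, r)) (T : 'M[C]_(r, m)).
Hypotheses (rkA : \rank A = r) (eA : A ^t* = S *m T).

(** Here S G T = A^* A A^*, and multiplying it by A on the right yields the
    Gram matrix of A^* A, so its rank is that of A. *)
Lemma ctrans_core_unit : T *m A *m S \in unitmx.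
Proof.
apply: (@core_unit _ _ _ _ S _ T).
have -> : S *m (T *m A *m S) *m T = A ^t* *m A *m A ^t*.
  by rewrite eA !mulmxA.
apply: leq_trans (mxrankM_maxl _ A).
have -> : A ^t* *m A *m A ^t* *m A = A ^t* *m A *m (A ^t* *m A) ^t*.
  by rewrite ctransM trmxCK !mulmxA.
rewrite mxrank_gram.
have -> : A ^t* *m A = A ^t* *m (A ^t*) ^t* by rewrite trmxCK.
by rewrite mxrank_gram mxrank_map mxrank_tr rkA.
Qed.

Lemma ctrans_core_penrose : mxpenrose A (S *m invmx (T *m A *m S) *m T).
Proof.
have uG := ctrans_core_unit; set G := T *m A *m S in uG *.
have ZAS : S *m invmx G *m T *m A *m S = S.
  by rewrite -2!mulmxA [T *m (A *m S)]mulmxA mulmxKV.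
apply: penrose_of_ctrans_cancel.
- by rewrite 2!mulmxA ZAS.
- rewrite eA -!mulmxA; congr (S *m _).
  by rewrite !mulmxA mulmxV // mul1mx.
- by rewrite eA mulmxA ZAS.
Qed.

End FullRank.
End MoorePenrose.

(** * The Drazin inverse of a matrix *)

Section DrazinRing.
Variable A : pzRingType.

Lemma outer_inverse_expand (b z : A) j :
  z * b * z = z -> b * z = z * b -> z = z ^+ j.+1 * b ^+ j.
Proof.
move=> zbz cbz; elim: j => [|j IH]; first by rewrite expr1 mulr1.
by rewrite exprS [b ^+ j.+1]exprSr mulrA -(mulrA z) -IH -mulrA -cbz mulrA zbz.
Qed.

(** Both solutions equal z b w: expand z = z^(k+1) b^k, or w = b^k w^(k+1),
    and replace b^k by b^(k+1) w, or by z b^(k+1). *)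
Lemma drazin_uniq (b z w : A) k :
  z * b * z = z -> b * z = z * b -> z * b ^+ k.+1 = b ^+ k ->
  w * b * w = w -> b * w = w * b -> w * b ^+ k.+1 = b ^+ k -> z = w.
Proof.
move=> zbz cbz zbk wbw cbw wbk.
have cwk i : w * b ^+ i = b ^+ i * w by apply: commrX.
have zE : z = z * b * w.
  rewrite {1}(outer_inverse_expand k zbz cbz) -wbk cwk [b ^+ _]exprSr !mulrA.
  by rewrite -(outer_inverse_expand k zbz cbz).
have wE : w = b ^+ k * w ^+ k.+1.
  rewrite {1}(outer_inverse_expand k wbw cbw).
  by apply/esym/commrX/commr_sym/commrX.
by rewrite zE [in RHS]wE -zbk exprS -!mulrA -wE.
Qed.

End DrazinRing.

Section DrazinMatrix.
Variable C : fieldType.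

(** A S and T A factor as S X and X T for the same X = T A T', where T' is a
    right inverse of T: since A S T = S T A, multiplying by T' gives A S = S X,
    and a left inverse of S then gives T A = X T.  Hence
    G = X (T S) = (T S) X commutes with X, and
    A (S G^-1 T) = S X G^-1 T = S G^-1 X T = (S G^-1 T) A. *)
Lemma drazin_core_comm m r (A : 'M[C]_m) (S : 'M[C]_(m, r)) (T : 'M[C]_(r, m)) :
  A *m (S *m T) = S *m T *m A -> T *m A *m S \in unitmx ->
  let Z := S *m invmx (T *m A *m S) *m T in A *m Z = Z *m A.
Proof.
set G := T *m A *m S => cA uG Z.
have eT : T *m (A *m (S *m invmx G)) = 1%:M by rewrite !mulmxA mulmxV.
have eS : invmx G *m T *m A *m S = 1%:M by rewrite -2!mulmxA [T *m _]mulmxA mulVmx.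
pose X := T *m A *m (A *m (S *m invmx G)).
have AS : A *m S = S *m X.
  by rewrite /X !mulmxA -cA -!mulmxA eT mulmx1.
have TA : T *m A = X *m T.
  rewrite -[LHS]mul1mx -eS -(mulmxA _ S) (mulmxA S) -cA (mulmxA A) AS.
  by rewrite -!(mulmxA S) (mulmxA _ S) eS mul1mx.
have cXG : X *m G = G *m X.
  have G_TSX : G = T *m S *m X by rewrite -mulmxA -AS mulmxA.
  have G_XTS : G = X *m T *m S by rewrite -TA.
  by rewrite {1}G_TSX G_XTS !mulmxA.
have cXV : X *m invmx G = invmx G *m X.
  apply: (can_inj (mulKmx uG)); rewrite mulmxA -cXG -mulmxA mulmxV //.
  by rewrite mulmx1 mulKVmx.
by rewrite /Z -[RHS]mulmxA TA !mulmxA AS -(mulmxA S X) cXV !mulmxA.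
Qed.

Section FullRank.
Variables (m r k : nat) (A : 'M[C]_m) (S : 'M[C]_(m, r)) (T : 'M[C]_(r, m)).
Hypothesis eA : A ^+ k = S *m T.

Lemma powmx_core_unit :
  (mxindex A <= k)%N -> \rank (A ^+ k) = r -> T *m A *m S \in unitmx.
Proof.
move=> kA rk; apply: (@core_unit _ _ _ _ S _ T).
have -> : S *m (T *m A *m S) *m T = A ^+ (k + k.+1).
  by rewrite exprD exprS -!mulmxE eA !mulmxA.
by rewrite -[X in (X <= _)%N]rk mxrankS // powmx_index_sub.
Qed.

Lemma powmx_core_drazin :
  T *m A *m S \in unitmx ->
  let Z := S *m invmx (T *m A *m S) *m T in
  [/\ Z *m A *m Z = Z, A *m Z = Z *m A & Z *m A ^+ k.+1 = A ^+ k].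
Proof.
move=> uG Z.
have ZAS : Z *m A *m S = S.
  by rewrite /Z -2!mulmxA [T *m (A *m S)]mulmxA mulmxKV.
split; first by rewrite {2}/Z 2!mulmxA ZAS.
  apply: drazin_core_comm => //; rewrite -eA mulmxE.
  exact: commrX.
by rewrite exprS -mulmxE mulmxA eA mulmxA ZAS.
Qed.

End FullRank.
End DrazinMatrix.

(** * From tensors to slices *)

Section Slices.
Variables (C : numClosedFieldType) (p : nat) (M : 'M[C]_p).
Hypothesis M_unit : M \in unitmx.

Lemma hat_inj m n (A B : tensor C m n p) :
  (forall i, hat M A i = hat M B i) -> A = B.
Proof. by move=> e; apply/(can_inj (hatK M_unit (n := n)))/ffunP. Qed.

Lemma hat_tinv n (A : tensor C n n p) i : hat M (tinv M A) i = invmx (hat M A i).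
Proof. by rewrite unhatK // ffunE. Qed.

Lemma hat_tctrans m n (A : tensor C m n p) i :
  hat M (tctrans M A) i = (hat M A i) ^t*.
Proof. by rewrite unhatK // ffunE. Qed.

Lemma hat_tpow n (A : tensor C n n p) j i : hat M (tpow M A j) i = hat M A i ^+ j.
Proof.
elim: j => [|j IH]; first by rewrite unhatK // ffunE.
by rewrite exprS -IH -mulmxE -hat_tprod.
Qed.

Lemma penroseP m n (A : tensor C m n p) (Z : tensor C n m p) :
  penrose M A Z <-> forall i, mxpenrose (hat M A i) (hat M Z i).
Proof.
split=> [[e1 e2 e3 e4] i|H].
  by split; rewrite -!(hat_tprod M_unit) -?hat_tctrans ?e1 ?e2 ?e3 ?e4.
by split; apply: hat_inj => i; case: (H i) => e1 e2 e3 e4;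
  rewrite ?hat_tctrans !(hat_tprod M_unit).
Qed.

(** The exponent is the tubal index for every slice, which may exceed the index
    of that slice. *)
Lemma drazin_eqsP m (B Z : tensor C m m p) :
  let k := tubal_index M B in
  drazin_eqs M B Z <->
  forall i, let b := hat M B i in let z := hat M Z i in
    [/\ z *m b *m z = z, b *m z = z *m b & z *m b ^+ k.+1 = b ^+ k].
Proof.
move=> k; split=> [[e1 e2 e3] i b z|H].
  by rewrite /b /z; split; rewrite -?hat_tpow -!(hat_tprod M_unit) ?e1 ?e2 ?e3.
split; apply: hat_inj => i; have [e1 e2 e3] := H i.
- by rewrite !(hat_tprod M_unit).
- by rewrite !(hat_tprod M_unit).
- by rewrite hat_tprod // !hat_tpow.
Qed.

Lemma mxrank_hat m n r (A : tensor C m n p) i :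
  multirank M A = [tuple r | _ < p] -> \rank (hat M A i) = r.
Proof. by move/(congr1 (fun t => tnth t i)); rewrite !tnth_mktuple. Qed.

End Slices.

Theorem corollary2p12 (R : realType) (m n p r k : nat) (M : 'M[R[i]]_p)
    (A : tensor R[i] m n p) (B : tensor R[i] m m p)
    (hM : M \in unitmx)
    (hA : multirank M A = [tuple r | _ < p])
    (hB : tubal_index M B = k) :
  (forall (S : tensor R[i] n r p) (T : tensor R[i] r m p),
      is_frd M (tctrans M A) S T ->
      tinvertible M (T *[M] A *[M] S) /\
      is_pinv M A (S *[M] tinv M (T *[M] A *[M] S) *[M] T))
  /\
  (forall (s : nat) (S : tensor R[i] m s p) (T : tensor R[i] s m p),
      is_frd M (tpow M B k) S T ->
      (multirank M (tpow M B k) = [tuple s | _ < p] ->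
         tinvertible M (T *[M] B *[M] S)) /\
      (tinvertible M (T *[M] B *[M] S) ->
         is_drazin M B (S *[M] tinv M (T *[M] B *[M] S) *[M] T))).
Proof.
split=> [S T [_ eA _ _] | s S T [_ eB _ _]].
  have eAi i : (hat M A i) ^t* = hat M S i *m hat M T i.
    by rewrite -hat_tctrans // eA hat_tprod.
  split=> [i|]; first by rewrite !hat_tprod // (ctrans_core_unit _ (eAi i)) //
    (mxrank_hat _ hA).
  have pZ : penrose M A (S *[M] tinv M (T *[M] A *[M] S) *[M] T).
    apply/penroseP => // i; rewrite !(hat_tprod, hat_tinv) //.
    by apply: ctrans_core_penrose => //; apply: mxrank_hat hA.
  split=> // W /(penroseP hM) pW; apply: (hat_inj hM) => i.
  by move/(penroseP hM): pZ => pZ; apply: mxpenrose_uniq (pZ i) (pW i).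
have eBi i : hat M B i ^+ k = hat M S i *m hat M T i.
  by rewrite -hat_tpow // eB hat_tprod.
split=> [rkB i|uG].
  rewrite !hat_tprod //; apply: (powmx_core_unit (eBi i)).
    by rewrite -hB; apply: (leq_bigmax i).
  by rewrite -hat_tpow // (mxrank_hat _ rkB).
have dZ : drazin_eqs M B (S *[M] tinv M (T *[M] B *[M] S) *[M] T).
  apply/drazin_eqsP => // i; rewrite !(hat_tprod, hat_tinv) // hB.
  by apply: powmx_core_drazin => //; have := uG i; rewrite !hat_tprod.
split=> // W /(drazin_eqsP hM) dW; apply: (hat_inj hM) => i.
move/(drazin_eqsP hM): dZ => /(_ i) [z1 z2 z3]; case: (dW i) => w1 w2 w3.
exact: drazin_uniq z1 z2 z3 w1 w2 w3.
Qed.
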